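(* For every integer $d \geq 4$ there is a polynomial $\tilde p \in \mathbb{C}[z]$ of degree $d$ with $d$ distinct roots such that the Jacobi variant of the Ehrlich--Aberth method for $\tilde p$, $\operatorname{JEA}_{\tilde p} \colon \mathbb{C}^d \dashrightarrow \mathbb{C}^d$, has diverging orbits in $\mathbb{C}^d$.
   Context: For a polynomial $p$ of degree $n$ and $(z_1,\dots,z_n)\in\mathbb{C}^n$ put $q_i(z) = \dfrac{p(z)}{\prod_{j\neq i}(z-z_j)}$ and $$\operatorname{EA}_p(z_i; z_1,\dots,\hat{z_i},\dots,z_n) = z_i - \frac{q_i(z_i)}{q_i'(z_i)},$$ where $q_i'$ is the derivative of $q_i$ with respect to $z$ and a hat means that the entry is omitted. This is regarded as a rational function of $z_1,\dots,z_n$. The Jacobi variant of the Ehrlich--Aberth method updates all coordinates in parallel: $\operatorname{JEA}_p \colon \mathbb{C}^n \dashrightarrow \mathbb{C}^n$ is the rational map sending $(z_1,\dots,z_n)$ to $(z_1',\dots,z_n')$ with $z_i' = \operatorname{EA}_p(z_i; z_1,\dots,\hat{z_i},\dots,z_n)$ for all $i$. A diverging orbit in $\mathbb{C}^n$ of a rational map $F\colon\mathbb{C}^n\dashrightarrow\mathbb{C}^n$ is an infinite forward orbit $(x^{j})_{j\ge 0}$ in $\mathbb{C}^n$ such that $F$ is well defined (regular) at each $x^j$, $x^{j+1}=F(x^j)\in\mathbb{C}^n$ for all $j$, and $\|x^j\|\to\infty$ as $j\to\infty$. *)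

(* Defs.v *)
From HB Require Import structures.
From mathcomp Require Import all_boot all_order all_algebra.
From mathcomp Require Import complex.
From mathcomp Require Import all_classical all_reals all_analysis.
(* Without notations: those of mpoly clash with those of the analysis
   library. *)
From mathcomp Require Import -(notations) mpoly.

Set Implicit Arguments.
Unset Strict Implicit.
Unset Printing Implicit Defensive.

Import Order.TTheory GRing.Theory Num.Theory.
Import numFieldNormedType.Exports.

Local Open Scope ring_scope.
Local Open Scope classical_set_scope.

(* The library has no derivative of rational functions; a rational function of
   one variable is given by a numerator and a denominator, and differentiated
   with the quotient rule. *)
Definition quot_eval (K : fieldType) (f g : {poly K}) (a : K) : K :=
  f.[a] / g.[a].

Definition quot_deriv_eval (K : fieldType) (f g : {poly K}) (a : K) : K :=
  (f^`().[a] * g.[a] - f.[a] * g^`().[a]) / g.[a] ^+ 2.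

(* The denominator of q_i(z) = p(z) / prod_(j != i) (z - z_j). *)
Definition EA_den (K : fieldType) (n : nat) (i : 'I_n) (z : 'I_n -> K) :
    {poly K} :=
  \prod_(j < n | j != i) ('X - (z j)%:P).

Definition EA (K : fieldType) (n : nat) (p : {poly K}) (i : 'I_n)
    (z : 'I_n -> K) : K :=
  z i - quot_eval p (EA_den i z) (z i) / quot_deriv_eval p (EA_den i z) (z i).

Definition ratfun (C : fieldType) (n : nat) : fieldType :=
  {fraction (mpoly n C)}.

Definition ratfun_const (C : fieldType) (n : nat) (c : C) : ratfun C n :=
  FracField.tofrac (mpolyC n c).

Definition ratfun_var (C : fieldType) (n : nat) (i : 'I_n) : ratfun C n :=
  FracField.tofrac (mpolyX C (mnm1 i)).

(* A rational map C^n --> C^n, as its tuple of components. *)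
Definition ratmap (C : fieldType) (n : nat) : Type := 'I_n -> ratfun C n.

(* The formula for EA is evaluated in the field C(z_1, ..., z_n), at the
   indeterminates themselves, so that JEA is a rational map and its domain of
   definition does not depend on the shape of the formula. *)
Definition JEA (C : fieldType) (n : nat) (p : {poly C}) : ratmap C n :=
  fun i => EA (map_poly (@ratfun_const C n) p) i (@ratfun_var C n).

Arguments JEA {C} n p.

(* f is regular at x, with value y: some fraction representing f has a
   denominator that does not vanish at x. *)
Definition ratfun_value (C : fieldType) (n : nat) (f : ratfun C n)
    (x : 'rV[C]_n) (y : C) : Prop :=
  exists a b : mpoly n C,
    [/\ f = FracField.tofrac a / FracField.tofrac b,
        meval (fun k => x 0 k) b != 0 &
        y = meval (fun k => x 0 k) a / meval (fun k => x 0 k) b].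

Definition ratmap_value (C : fieldType) (n : nat) (F : ratmap C n)
    (x y : 'rV[C]_n) : Prop :=
  forall i, ratfun_value (F i) x (y 0 i).

Definition cnorm (R : realType) (n : nat) (x : 'rV[complex R]_n) : R :=
  Num.sqrt (\sum_(i < n) ComplexField.Normc.normc (x 0 i) ^+ 2).

Definition diverging_orbit (R : realType) (n : nat)
    (F : ratmap (complex R) n) (x : nat -> 'rV[complex R]_n) : Prop :=
  (forall j, ratmap_value F (x j) (x j.+1)) /\
  cnorm (x j) @[j --> \oo] --> +oo.

(* Main.v *)
Require Import Defs.
From mathcomp Require Import all_boot all_order all_algebra.
From mathcomp Require Import complex.
From mathcomp Require Import all_classical all_reals all_analysis.
From mathcomp Require Import ring lra.
(* Its notations clash with those of the files above. *)
From mathcomp Require Import -(notations) mpoly.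

(** Write the method as 1 / (z_i - z_i') = N_i with
      N_i = p'(z_i) / p(z_i) - \sum_(j != i) 1 / (z_i - z_j).
    N_i is a sum of terms 1 / (z_i - y), with sign + for the d roots of p and
    sign - for the d - 1 other coordinates.  As the signs add up to 1, the
    method commutes with every Moebius transformation acting on the roots and
    on the coordinates at the same time ([newton_step_mobius]).  Infinity is
    therefore a point of the projective line like any other, and an orbit
    diverges as soon as it is attracted by a cycle of the method on (P^1)^d in
    which, at every time, some coordinate is infinite.

    For d = 4, take the four points oo, 1, w, w^2 of P^1, where w is a primitive
    cube root of unity.  Requiring that the method exchanges oo with 1 and w
    with w^2 is a linear condition on p, a solution of which is
      p = z^4 - z^3 + 8 z + 1.
    The Klein four-group of Moebius transformations that preserve these four
    points consists of the identity and of the involutions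
      v_r(z) = r (z + 2 r) / (z - r),   with r = 1, w, w^2,
    and it preserves the roots of p ([quartic_flip]).  By equivariance the
    method preserves the curve of orbits (u, v_1 u, v_w u, v_(w^2) u) of this
    group: it replaces u by some rational function of u, which we write as
    v_1 (T u), so that the new configuration is the orbit of T u with its
    coordinates exchanged in pairs ([klein_config_step]).  Here
    T u ~ - u^2 / 18 at infinity, so that oo is superattracting on this curve.
    T has real coefficients, and T u <= 2 u for u <= -200 ([escape_map_le]);
    starting from u = -200, the coordinates 0 and 1 are in turn equal to the
    iterate of T, which tends to -oo.

    For d > 4, multiply p by \prod_k (z - a_k), with a_k = 2, 3, 4, ..., and put
    the k-th additional coordinate at a_k.  A coordinate at a simple root of
    the polynomial does not move ([JEA_value_simple_root]), and for the first
    four coordinates the additional roots and the additional coordinates cancel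
    in N_i ([JEA_value_newton_sum]). *)

Set Implicit Arguments.
Unset Strict Implicit.
Unset Printing Implicit Defensive.

Import Order.TTheory GRing.Theory Num.Theory.
Import numFieldNormedType.Exports.

Local Open Scope ring_scope.
Local Open Scope classical_set_scope.

(** * Values of the rational map *)

Lemma newton_step_quot (F : fieldType) (a f g w : F) :
  g != 0 -> w != 0 -> a - f / g / (w / g ^+ 2) = (a * w - f * g) / w.
Proof. by move=> g0 w0; field; rewrite g0 w0. Qed.

Section Evaluation.
Variables (C : fieldType) (n : nat) (p : {poly C}) (x : 'rV[C]_n) (i : 'I_n).

(** The regularity hypothesis is the non-vanishing of [w]: cleared of
    denominators, the formula for the i-th component is a quotient of images of
    polynomials in the coordinates, with denominator p' g - p g'. *)
Lemma JEA_value (y : C) (g := EA_den i (fun k => x 0 k)) (a := x 0 i)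
    (w := p^`().[a] * g.[a] - p.[a] * g^`().[a]) :
  g.[a] != 0 -> w != 0 -> (a - y) * w = p.[a] * g.[a] ->
  ratfun_value (JEA n p i) x y.
Proof.
move=> g0 w0 yE.
(* [ev] evaluates at [x]; [t], below, embeds polynomials in the rational
   functions.  P, G, W are the generic versions of p, g, w. *)
pose A : idomainType := mpoly.mpoly n C.
pose X : 'I_n -> A := fun k => mpoly.mpolyX C (mpoly.mnm1 k).
pose ev : {rmorphism A -> C} := mpoly.meval (fun k => x 0 k).
pose P : {poly A} := map_poly (@mpoly.mpolyC n C) p.
pose G : {poly A} := \prod_(j < n | j != i) ('X - (X j)%:P).
pose W := P^`().[X i] * G.[X i] - P.[X i] * G^`().[X i].
have evX k : ev (X k) = x 0 k by rewrite /ev /X /= mpoly.mevalXU.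
have evP : map_poly ev P = p.
  rewrite /P -map_poly_comp map_poly_id // => c _ /=.
  exact: mpoly.mevalC.
have evG : map_poly ev G = g.
  rewrite /G rmorph_prod /=; apply: eq_bigr => j _.
  by rewrite rmorphB /= map_polyX map_polyC /= evX.
have ev_horner (Q : {poly A}) : ev Q.[X i] = (map_poly ev Q).[a].
  by rewrite -horner_map evX.
have evW : ev W = w.
  by rewrite /W rmorphB !rmorphM !ev_horner -!deriv_map evP evG.
have G0 : G.[X i] != 0.
  by apply: contraNneq g0 => G0; rewrite -evG -ev_horner G0 rmorph0.
have W0 : W != 0.
  by apply: contraNneq w0 => W0; rewrite -evW W0 rmorph0.
exists (X i * W - P.[X i] * G.[X i]), W; split.
- pose t : {rmorphism A -> ratfun C n} := @tofrac A.
  have tP : map_poly (@ratfun_const C n) p = map_poly t P.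
    by rewrite /P -map_poly_comp.
  have tG : EA_den i (@ratfun_var C n) = map_poly t G.
    rewrite /G rmorph_prod /=; apply: eq_bigr => j _.
    by rewrite rmorphB /= map_polyX map_polyC.
  rewrite /JEA /EA tP tG /quot_eval /quot_deriv_eval.
  have tG0 : t G.[X i] != 0 by rewrite /t /= tofrac_eq0.
  have tW0 : t W != 0 by rewrite /t /= tofrac_eq0.
  rewrite -[ratfun_var C i]/(t (X i)) (deriv_map t P) (deriv_map t G).
  rewrite !horner_map.
  rewrite -[tofrac (_ - _)]/(t _) -[tofrac W]/(t W) rmorphB !rmorphM.
  have -> : t P^`().[X i] * t G.[X i] - t P.[X i] * t G^`().[X i] = t W.
    by rewrite /W rmorphB !rmorphM.
  by rewrite (newton_step_quot (t (X i)) (t P.[X i]) tG0 tW0).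
- by rewrite -/ev evW.
- rewrite -[meval _ (_ - _)]/(ev _) rmorphB !rmorphM evW evX !ev_horner.
  rewrite evP evG -yE.
  by rewrite [(a - y) * w]mulrBl subKr -[meval _ W]/(ev W) evW mulfK.
Qed.

End Evaluation.

Section NewtonSum.
Variable F : fieldType.
Implicit Types (p h : {poly F}) (s t : seq F) (z y : F).

Definition root_poly s : {poly F} := \prod_(y <- s) ('X - y%:P).

(** The inverse of the displacement z - z' of a coordinate at z, when the other
    coordinates are the entries of [s]. *)
Definition newton_sum p s z : F :=
  p^`().[z] / p.[z] - \sum_(y <- s) (z - y)^-1.

Lemma root_poly_neq0 s z : z \notin s -> (root_poly s).[z] != 0.
Proof. by rewrite -[_ == 0]/(root _ z) root_prod_XsubC. Qed.

Lemma root_poly_logderiv s z : z \notin s ->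
  (root_poly s)^`().[z] = (root_poly s).[z] * \sum_(y <- s) (z - y)^-1.
Proof.
rewrite /root_poly; elim: s => [|y s IH].
  by rewrite !big_nil -polyC1 derivC horner0 mulr0.
rewrite inE negb_or => /andP[zy zs].
rewrite !big_cons derivM derivXsubC mul1r !hornerE (IH zs).
have {}zy : z - y != 0 by rewrite subr_eq0.
by field.
Qed.

Lemma root_poly_deriv_neq0 s z :
  uniq s -> z \in s -> (root_poly s)^`().[z] != 0.
Proof.
move=> us zs; rewrite /root_poly (perm_big _ (perm_to_rem zs)) big_cons.
rewrite derivM derivXsubC mul1r hornerD hornerM hornerXsubC subrr mul0r addr0.
by rewrite root_poly_neq0 // mem_rem_uniqF.
Qed.

Lemma wronskian_newton_sum p s z (g := root_poly s) :
  z \notin s -> p.[z] != 0 ->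
  p^`().[z] * g.[z] - p.[z] * g^`().[z] = p.[z] * g.[z] * newton_sum p s z.
Proof.
by move=> zs p0; rewrite root_poly_logderiv // /newton_sum -/g; field.
Qed.

(** This is why a root shared by the polynomial and the other coordinates does
    not change the method. *)
Lemma wronskian_common_factor p g h z :
  (p * h)^`().[z] * (g * h).[z] - (p * h).[z] * (g * h)^`().[z]
  = h.[z] ^+ 2 * (p^`().[z] * g.[z] - p.[z] * g^`().[z]).
Proof. by rewrite !derivM !(hornerM, hornerD); ring. Qed.

Lemma EA_den_root_poly n s t (i : 'I_n) : size s = n -> perm_eq s (s`_i :: t) ->
  EA_den i (fun k => (\row_(k < n) s`_k) 0 k) = root_poly t.
Proof.
move=> sz st; have X0 : 'X - (s`_i)%:P != 0 by rewrite polyXsubC_eq0.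
apply: (mulfI X0); transitivity (root_poly s).
  rewrite /root_poly (big_nth 0) big_mkord sz (bigD1 i) //=; congr (_ * _).
  by apply: eq_bigr => j _; rewrite mxE.
by rewrite /root_poly (perm_big _ st) big_cons.
Qed.

Variables (n : nat) (s : seq F) (i : 'I_n).
Hypotheses (sz : size s = n) (us : uniq s).

(** The entries of [a] are both roots of the polynomial and coordinates, and
    they cancel. *)
Lemma JEA_value_newton_sum p t a (z' : F) (z := s`_i) :
    perm_eq s (z :: t ++ a) -> p.[z] != 0 -> newton_sum p t z * (z - z') = 1 ->
  ratfun_value (JEA n (p * root_poly a) i) (\row_(k < n) s`_k) z'.
Proof.
move=> st p0 zz'; move: us; rewrite (perm_uniq st) /= mem_cat negb_or.
case/andP => /andP[zt za] _.
have t0 := root_poly_neq0 zt; have a0 := root_poly_neq0 za.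
have N0 : newton_sum p t z != 0.
  by apply: contra_eq_neq zz' => ->; rewrite mul0r eq_sym oner_eq0.
have den : EA_den i (fun k => (\row_(k < n) s`_k) 0 k)
    = root_poly t * root_poly a.
  by rewrite (EA_den_root_poly sz st) /root_poly big_cat.
apply: JEA_value; rewrite den mxE -/z.
- by rewrite hornerM mulf_neq0.
- rewrite wronskian_common_factor wronskian_newton_sum //.
  by rewrite !mulf_neq0 ?expf_neq0.
- rewrite wronskian_common_factor wronskian_newton_sum // !hornerM.
  by rewrite -[RHS]mulr1 -zz'; ring.
Qed.

Lemma JEA_value_simple_root q (z := s`_i) : root q z -> q^`().[z] != 0 ->
  ratfun_value (JEA n q i) (\row_(k < n) s`_k) z.
Proof.
move=> /rootP q0 q'0; have i_s : (i < size s)%N by rewrite sz.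
have st := perm_to_rem (mem_nth 0 i_s).
have zt : z \notin rem z s by rewrite mem_rem_uniqF.
apply: JEA_value; rewrite (EA_den_root_poly sz st) mxE -/z ?q0 ?mul0r ?subr0.
- exact: root_poly_neq0.
- by rewrite mulf_neq0 // root_poly_neq0.
- by rewrite subrr mul0r.
Qed.

End NewtonSum.

(** * Moebius equivariance *)

Section Mobius.
Variables (F : fieldType) (a b c d : F).
Implicit Types (p : {poly F}) (s : seq F) (z y : F).

Definition mobius z : F := (a * z + b) / (c * z + d).

Lemma mobius_sub z y : c * z + d != 0 -> c * y + d != 0 ->
  mobius z - mobius y
  = (a * d - b * c) * (z - y) / ((c * z + d) * (c * y + d)).
Proof. by move=> z0 y0; rewrite /mobius; field; rewrite z0 y0. Qed.

Hypothesis det0 : a * d - b * c != 0.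

(** Each term transforms by
      det / (v z - v y) = (c z + d)^2 / (z - y) - c (c z + d).
    The hypothesis is the sum of this law over the roots of p, when there are
    [(size s).+1] of them and v permutes them.  In the difference with the sum
    over [s], the correction term is left exactly once. *)
Lemma newton_sum_mobius p s z :
    c * z + d != 0 -> z \notin s -> all (fun y => c * y + d != 0) s ->
    p^`().[mobius z] / p.[mobius z] * (a * d - b * c)
      = (c * z + d) ^+ 2 * (p^`().[z] / p.[z])
        - (size s).+1%:R * (c * (c * z + d)) ->
  newton_sum p (map mobius s) (mobius z) * (a * d - b * c)
  = (c * z + d) ^+ 2 * newton_sum p s z - c * (c * z + d).
Proof.
move=> z0 zs s0 hp; rewrite /newton_sum mulrBl hp big_map.
suff -> : (\sum_(y <- s) (mobius z - mobius y)^-1) * (a * d - b * c)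
    = (c * z + d) ^+ 2 * (\sum_(y <- s) (z - y)^-1)
      - (size s)%:R * (c * (c * z + d)) by rewrite -natr1; ring.
elim: s zs s0 {hp} => [|y s IH] /=; first by move=> _ _; rewrite !big_nil; ring.
rewrite inE negb_or => /andP[zy zs] /andP[y0 s0].
rewrite !big_cons mulrDl (IH zs s0) mobius_sub // -natr1.
have {}zy : z - y != 0 by rewrite subr_eq0.
by move: (\sum_(j <- s) _) => S; field; rewrite z0 y0 zy det0.
Qed.

(** The law of [newton_sum_mobius] is the one that 1 / (z - z') obeys. *)
Lemma newton_step_mobius p s z z' :
    c * z + d != 0 -> c * z' + d != 0 -> z \notin s ->
    all (fun y => c * y + d != 0) s ->
    p^`().[mobius z] / p.[mobius z] * (a * d - b * c)
      = (c * z + d) ^+ 2 * (p^`().[z] / p.[z])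
        - (size s).+1%:R * (c * (c * z + d)) ->
    newton_sum p s z * (z - z') = 1 ->
  newton_sum p (map mobius s) (mobius z) * (mobius z - mobius z') = 1.
Proof.
move=> z0 z'0 zs s0 hp N1; have hN := newton_sum_mobius z0 zs s0 hp.
rewrite mobius_sub // !mulrA hN mulrBl -(mulrA _ _ (z - z')) N1.
by field; rewrite z0 z'0.
Qed.

End Mobius.

(** * The quartic and its Klein four-group *)

Section KleinOrbit.
Variable F : numFieldType.
Implicit Types (z u r t : F).

Definition quartic : {poly F} := 'X^4 - 'X^3 + 8%:P * 'X + 1.

Lemma horner_quartic z : quartic.[z] = z ^+ 4 - z ^+ 3 + 8 * z + 1.
Proof. by rewrite /quartic !hornerE. Qed.

Lemma horner_deriv_quartic z :
  quartic^`().[z] = 4 * z ^+ 3 - 3 * z ^+ 2 + 8.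
Proof.
rewrite /quartic -polyC1 !(derivD, derivN, derivXn, derivM, derivC, derivX).
by rewrite !hornerE /=; ring.
Qed.

Lemma size_quartic : size quartic = 5.
Proof.
have -> : quartic
    = ((('X - 1%:P) * 'X + 0%:P) * 'X + 8%:P) * 'X + 1%:P.
  by rewrite /quartic polyC0 polyC1; ring.
by rewrite !size_MXaddC size_XsubC polyXsubC_eq0 oner_eq0 pnatr_eq0 !andbF.
Qed.

Lemma quartic_no_double_root z :
  root quartic z -> quartic^`().[z] != 0.
Proof.
move=> /rootP; rewrite horner_quartic horner_deriv_quartic => q0.
(* A Bezout relation between p and p', computed by linear algebra. *)
apply/eqP => q'0; have /eqP : 189%:R = 0 :> F.
  transitivity ((-3 + 16 * z - 16 * z ^+ 2) * (z ^+ 4 - z ^+ 3 + 8 * z + 1)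
    + (24 + z - 5 * z ^+ 2 + 4 * z ^+ 3) * (4 * z ^+ 3 - 3 * z ^+ 2 + 8)).
    by ring.
  by rewrite q0 q'0 !mulr0 addr0.
by rewrite pnatr_eq0.
Qed.

(** For a cube root of unity [r], the involution that exchanges infinity with
    [r] and the two other cube roots of unity with each other. *)
Definition flip r z : F := mobius r (2 * r ^+ 2) 1 (- r) z.

Lemma flipE r z : flip r z = r * (z + 2 * r) / (z - r).
Proof. by rewrite /flip /mobius mul1r; congr (_ / _); ring. Qed.

(** So [flip r] permutes the roots of [quartic].  With the powers of r^3 = 1
    inserted in the coefficients, z^4 + 8 r^3 z and z^3 - r^3 are homogeneous in
    z and r, and the identity holds for every r. *)
Lemma quartic_flip r z : r ^+ 3 = 1 -> z != r ->
  quartic.[flip r z] * (z - r) ^+ 4 = 9 * r * quartic.[z].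
Proof.
move=> r3 zr; have {}zr : z - r != 0 by rewrite subr_eq0.
have E x : quartic.[x] = x ^+ 4 + 8 * r ^+ 3 * x - (x ^+ 3 - r ^+ 3).
  by rewrite horner_quartic r3; ring.
have -> : 9 * r = 9 * r ^+ 4 by rewrite exprSr r3 mul1r.
by rewrite !E flipE; field.
Qed.

(** The derivative of [quartic_flip] with respect to [z], where
    - 3 r^2 / (z - r)^2 is the derivative of [flip r]. *)
Lemma deriv_quartic_flip r z : r ^+ 3 = 1 -> z != r ->
  quartic^`().[flip r z] * (- 3 * r ^+ 2) * (z - r) ^+ 2
    + 4 * (z - r) ^+ 3 * quartic.[flip r z] = 9 * r * quartic^`().[z].
Proof.
move=> r3 zr; have {}zr : z - r != 0 by rewrite subr_eq0.
have E x : quartic.[x] = x ^+ 4 + 8 * r ^+ 3 * x - (x ^+ 3 - r ^+ 3).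
  by rewrite horner_quartic r3; ring.
have E' x : quartic^`().[x] = 4 * x ^+ 3 - 3 * x ^+ 2 + 8 * r ^+ 3.
  by rewrite horner_deriv_quartic r3; ring.
have -> : 9 * r = 9 * r ^+ 4 by rewrite exprSr r3 mul1r.
by rewrite E !E' flipE; field.
Qed.

(** The quotient of the two previous identities, in the form that
    [newton_sum_mobius] requires. *)
Lemma quartic_flip_logderiv r z :
    r ^+ 3 = 1 -> z != r -> quartic.[z] != 0 ->
  quartic^`().[flip r z] / quartic.[flip r z] * (r * - r - 2 * r ^+ 2 * 1)
  = (1 * z + - r) ^+ 2 * (quartic^`().[z] / quartic.[z])
    - 4%:R * (1 * (1 * z + - r)).
Proof.
move=> r3 zr p0; have p1 := quartic_flip r3 zr.
have p2 := deriv_quartic_flip r3 zr; have {}zr : z - r != 0 by rewrite subr_eq0.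
have r0 : r != 0.
  by apply: contra_eq_neq r3 => ->; rewrite expr0n eq_sym oner_eq0.
have q0 : quartic.[flip r z] != 0.
  apply: contraNneq p0 => q0; move/eqP: p1; rewrite q0 mul0r eq_sym !mulf_eq0.
  by rewrite (negPf r0) pnatr_eq0 orbF.
have -> : quartic^`().[z]
    = (quartic^`().[flip r z] * (- 3 * r ^+ 2) * (z - r) ^+ 2
      + 4 * (z - r) ^+ 3 * quartic.[flip r z]) / (9 * r).
  by rewrite p2 mulrAC mulfV ?mul1r // mulf_neq0 // pnatr_eq0.
have -> : quartic.[z] = quartic.[flip r z] * (z - r) ^+ 4 / (9 * r).
  by rewrite p1 mulrAC mulfV ?mul1r // mulf_neq0 // pnatr_eq0.
by field; rewrite q0 zr r0.
Qed.

End KleinOrbit.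

Section KleinStep.
Variable F : numFieldType.
Implicit Types (z u r t : F).

Lemma flip_sub r t z : r ^+ 2 + r * t + t ^+ 2 = 0 -> z != t ->
  flip t z - r = (t - r) * (z + (r + t)) / (z - t).
Proof.
move=> h zt; have {}zt : z - t != 0 by rewrite subr_eq0.
apply/eqP; rewrite flipE -subr_eq0; apply/eqP.
transitivity ((r ^+ 2 + r * t + t ^+ 2) / (z - t)); first by field.
by rewrite h mul0r.
Qed.

Lemma cube_neq1 z r : z ^+ 3 != 1 -> r ^+ 3 = 1 -> z != r.
Proof. by move=> z3 r3; apply: contraNneq z3 => ->; apply/eqP. Qed.

Lemma cube_root_neq0 r : r ^+ 3 = 1 -> r != 0.
Proof. by apply: contra_eq_neq => ->; rewrite expr0n eq_sym oner_eq0. Qed.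

(** [flip r] permutes the set of infinity and the cube roots of unity, hence it
    preserves the complement. *)
Lemma flip_cube r z : r ^+ 3 = 1 -> z ^+ 3 != 1 -> (flip r z) ^+ 3 != 1.
Proof.
move=> r3 z3; have zr : z - r != 0 by rewrite subr_eq0 cube_neq1.
rewrite -subr_eq0.
have -> : flip r z ^+ 3 - 1 = 9 * r * (z ^+ 3 - 1) / (z - r) ^+ 4.
  have : (r * (z + 2 * r) / (z - r)) ^+ 3 - r ^+ 3
    = 9 * (r * r ^+ 3) * (z ^+ 3 - r ^+ 3) / (z - r) ^+ 4 by field.
  by rewrite flipE r3 mulr1.
by rewrite !mulf_neq0 ?invr_neq0 ?expf_neq0 ?(cube_root_neq0 r3) ?zr ?pnatr_eq0
           ?subr_eq0.
Qed.

(** The multiplication table of the Klein four-group. *)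
Lemma flip_flip r t q z : r ^+ 3 = 1 -> t ^+ 3 = 1 -> q ^+ 3 = 1 ->
  r != t -> r + t + q = 0 -> z ^+ 3 != 1 -> flip r (flip t z) = flip q z.
Proof.
move=> r3 t3 q3 rt /eqP; rewrite addr_eq0 => /eqP qE z3.
have {}rt : t - r != 0 by rewrite subr_eq0 eq_sym.
have h : r ^+ 2 + r * t + t ^+ 2 = 0.
  apply: (mulfI rt); rewrite mulr0.
  transitivity (t ^+ 3 - r ^+ 3); first by ring.
  by rewrite r3 t3 subrr.
have zt := cube_neq1 z3 t3; have zq := cube_neq1 z3 q3.
have {}qE : q = - (r + t) by rewrite qE opprK.
subst q; rewrite flipE flip_sub // !flipE opprK.
rewrite -subr_eq0 opprK in zq; rewrite -subr_eq0 in zt.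
apply/eqP; rewrite -subr_eq0; apply/eqP.
transitivity ((r ^+ 2 + r * t + t ^+ 2) * (z - 2 * (t - r))
    / ((t - r) * (z + (r + t)))).
  by field; rewrite zq zt rt.
by rewrite h !mul0r.
Qed.

Lemma flip_self_sub r z : z != r -> flip r z - r = 3 * r ^+ 2 / (z - r).
Proof. by rewrite -subr_eq0 flipE => zr; field. Qed.

Lemma flipK r z : r != 0 -> z != r -> flip r (flip r z) = z.
Proof.
move=> r0 zr; rewrite flipE flip_self_sub // flipE.
rewrite -subr_eq0 in zr.
by field; rewrite zr r0.
Qed.

Lemma cube_root_eq r t : r + t = -1 -> r * t = 1 -> r ^+ 2 + r + 1 = 0.
Proof.
move=> rtD rtM; transitivity (r * (r + t) + r + 1 - r * t); first by ring.
by rewrite rtD rtM; ring.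
Qed.

Lemma cube_root_exp r : r ^+ 2 + r + 1 = 0 -> r ^+ 3 = 1.
Proof.
move=> r2; apply/eqP; rewrite -subr_eq0; apply/eqP.
by transitivity ((r - 1) * (r ^+ 2 + r + 1)); [ring | rewrite r2 mulr0].
Qed.

(** * The step on a Klein orbit *)

(** The two primitive cube roots of unity. *)
Variables w v : F.
Hypotheses (wv1 : w + v = -1) (wvM : w * v = 1).

Let w3 : w ^+ 3 = 1 := cube_root_exp (cube_root_eq wv1 wvM).

Let v3 : v ^+ 3 = 1.
Proof.
by apply: cube_root_exp; apply: (@cube_root_eq _ w); rewrite 1?addrC 1?mulrC.
Qed.

Let o3 : 1 ^+ 3 = 1 :> F := expr1n _ _.

(** p'(u) W(u) - p(u) W'(u) / 2, where W = u^6 - 20 u^3 - 8 vanishes at the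
    fixed points of the three involutions.  It is p W times the Newton sum at u:
    the orbit of u consists of the roots in z of
      f(z) = z^4 + 8 z - c (z^3 - 1),  with c = (u^4 + 8 u) / (u^3 - 1),
    and f'(u) = W(u) / (u^3 - 1), f''(u) = W'(u) / (u^3 - 1), so that the
    inverses of the differences of u with the other three points add up to
    f''(u) / (2 f'(u)) = W'(u) / (2 W(u)). *)
Definition escape_num u : F :=
  u ^+ 9 - 66 * u ^+ 6 + 27 * u ^+ 5 + 48 * u ^+ 3 + 54 * u ^+ 2 - 64.

(** Defined by (u - 1) [escape_num u] + 9 [escape_den u] = p(u) W(u). *)
Definition escape_den u : F :=
  6 * u ^+ 7 - 8 * u ^+ 6 + 3 * u ^+ 5 - 24 * u ^+ 4 - 2 * u ^+ 3
    + 6 * u ^+ 2 - 8.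

(** The map T of the introduction.  Solving v_1 (T u) = u - p W / [escape_num u]
    with the previous identity gives
      v_1 (T u) = 1 - 9 [escape_den u] / [escape_num u],
    and v_1 x = 1 + 3 / (x - 1). *)
Definition escape_map u : F := 1 - escape_num u / (3 * escape_den u).

Lemma newton_step_base u :
    u ^+ 3 != 1 -> u ^+ 6 - 20 * u ^+ 3 - 8 != 0 -> (quartic F).[u] != 0 ->
    escape_num u != 0 -> escape_den u != 0 ->
  newton_sum (quartic F) [:: flip 1 u; flip w u; flip v u] u
    * (u - flip 1 (escape_map u)) = 1.
Proof.
move=> u3 W0 p0 B0 C0; have fne (r : F) : r ^+ 3 = 1 -> u != r.
  by move=> r3; apply: contraNneq u3 => ->; apply/eqP.
have sub r : u != r ->
    (u - flip r u)^-1 = (u - r) / (u ^+ 2 - 2 * r * u - 2 * r ^+ 2).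
  rewrite -subr_eq0 => ur; rewrite flipE -[RHS]invf_div; congr (_^-1).
  by field.
rewrite /newton_sum !big_cons big_nil addr0 !sub ?fne ?w3 ?v3 ?expr1n //.
set qw := u ^+ 2 - 2 * w * u - _; set qv := u ^+ 2 - 2 * v * u - _.
(* [qw * qv] and the sum of the two fractions are symmetric in [w] and [v]. *)
have Q : qw * qv = u ^+ 4 + 2 * u ^+ 3 + 6 * u ^+ 2 - 4 * u + 4.
  transitivity (u ^+ 4 - 2 * u ^+ 3 * (w + v)
    + u ^+ 2 * (4 * (w * v) - 2 * ((w + v) ^+ 2 - 2 * (w * v)))
    + 4 * u * (w * v) * (w + v) + 4 * (w * v) ^+ 2).
    by rewrite /qw /qv; ring.
  by rewrite wv1 wvM; ring.
have S : (u - w) * qv + (u - v) * qw = 2 * u ^+ 3 + 3 * u ^+ 2 + 6 * u - 2.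
  transitivity (2 * u ^+ 3 - 3 * u ^+ 2 * (w + v)
    - 2 * u * ((w + v) ^+ 2 - 2 * (w * v)) + 4 * u * (w * v)
    + 2 * (w * v) * (w + v)).
    by rewrite /qw /qv; ring.
  by rewrite wv1 wvM; ring.
have WE : u ^+ 6 - 20 * u ^+ 3 - 8
    = (u ^+ 2 - 2 * 1 * u - 2 * 1 ^+ 2) * (qw * qv).
  by rewrite Q; ring.
move: W0; rewrite WE !mulf_eq0 !negb_or => /and3P[q1 qw0 qv0].
have -> : (u - w) / qw + (u - v) / qv
    = ((u - w) * qv + (u - v) * qw) / (qw * qv).
  by field; rewrite qw0 qv0.
have Q0 : qw * qv != 0 by rewrite mulf_neq0.
have -> : u - flip 1 (escape_map u)
    = (quartic F).[u] * ((u ^+ 2 - 2 * 1 * u - 2 * 1 ^+ 2) * (qw * qv))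
      / escape_num u.
  transitivity (((u - 1) * escape_num u + 9 * escape_den u) / escape_num u).
    rewrite flipE /escape_map; field; rewrite B0 C0 /=.
    have -> : 3 * escape_den u - escape_num u + -1 * (3 * escape_den u)
        = - escape_num u.
      by ring.
    by rewrite oppr_eq0.
  by congr (_ * _^-1); rewrite Q horner_quartic /escape_num /escape_den; ring.
have BE : escape_num u = (quartic F)^`().[u] * (u ^+ 6 - 20 * u ^+ 3 - 8)
    - (quartic F).[u] * (3 * u ^+ 5 - 30 * u ^+ 2).
  by rewrite horner_quartic horner_deriv_quartic /escape_num; ring.
move: B0; rewrite S BE; move: Q0 q1; rewrite Q.
move: ((quartic F)^`().[u]) p0 => p' p0 Q0 q1 B0'; field.
by rewrite B0' Q0 p0 andbT /=; move: q1; rewrite expr1n !mulr1.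
Qed.

(** The orbit of [u] under the Klein four-group.  The boolean says whether its
    entries are exchanged in pairs, as the method does at every step. *)
Definition klein_config (b : bool) u : seq F :=
  if b then [:: flip 1 u; u; flip v u; flip w u]
  else [:: u; flip 1 u; flip w u; flip v u].

Lemma newton_step_flip r s u z :
    r ^+ 3 = 1 -> u ^+ 3 != 1 -> z ^+ 3 != 1 -> u \notin s ->
    all (fun y => y ^+ 3 != 1) s -> size s = 3 -> (quartic F).[u] != 0 ->
    newton_sum (quartic F) s u * (u - z) = 1 ->
  newton_sum (quartic F) (map (flip r) s) (flip r u) * (flip r u - flip r z)
  = 1.
Proof.
move=> r3 u3 z3 us /allP s3 sz p0 N1.
have shift y : y ^+ 3 != 1 -> 1 * y + - r != 0.
  by move=> y3; rewrite mul1r subr_eq0 cube_neq1.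
apply: newton_step_mobius; rewrite ?shift //.
- rewrite (_ : _ - _ = (-3) * r ^+ 2); last by ring.
  by rewrite mulf_neq0 ?oppr_eq0 ?pnatr_eq0 ?expf_neq0 ?cube_root_neq0.
- by apply/allP => y /s3; exact: shift.
- by rewrite sz; exact: (quartic_flip_logderiv r3 (cube_neq1 u3 r3) p0).
Qed.

Lemma quartic_flip_neq0 r u : r ^+ 3 = 1 -> u != r ->
  (quartic F).[u] != 0 -> (quartic F).[flip r u] != 0.
Proof.
move=> r3 ur; apply: contraNneq => q0; move: (quartic_flip r3 ur).
rewrite q0 mul0r => /esym/eqP; rewrite !mulf_eq0 (negPf (cube_root_neq0 r3)).
by rewrite pnatr_eq0.
Qed.

Hypothesis wv : w != v.

Let ow : 1 != w.
Proof. by apply: contra_neq wv => w1; move: wvM; rewrite -w1 mul1r => ->. Qed.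

Let ov : 1 != v.
Proof. by apply: contra_neq wv => v1; move: wvM; rewrite -v1 mulr1. Qed.

(** The points of the orbit are finite (first condition), pairwise distinct
    (second condition) and not roots of the quartic; the last two conditions say
    that the image of the step is finite. *)
Definition klein_generic u :=
  [&& u ^+ 3 != 1, u ^+ 6 - 20 * u ^+ 3 - 8 != 0, (quartic F).[u] != 0,
      escape_num u != 0 & escape_den u != 0].

Lemma flip_neq r u : r ^+ 3 = 1 -> u ^+ 3 != 1 ->
  u ^+ 6 - 20 * u ^+ 3 - 8 != 0 -> flip r u != u.
Proof.
move=> r3 u3 W0; have ur := cube_neq1 u3 r3.
rewrite eq_sym -subr_eq0; apply: contraNneq W0 => fu.
have q0 : u ^+ 2 - 2 * r * u - 2 * r ^+ 2 = 0.
  rewrite -subr_eq0 in ur; apply: (mulIf (invr_neq0 ur)).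
  by rewrite mul0r -fu flipE; field.
apply/eqP; transitivity (u ^+ 6 - 20 * r ^+ 3 * u ^+ 3 - 8 * (r ^+ 3) ^+ 2).
  by rewrite r3; ring.
transitivity ((u ^+ 2 - 2 * r * u - 2 * r ^+ 2) *
  (u ^+ 4 + 2 * r * u ^+ 3 + 6 * r ^+ 2 * u ^+ 2 - 4 * r ^+ 3 * u
   + 4 * r ^+ 4)).
  by ring.
by rewrite q0 mul0r.
Qed.

Lemma flip_group u (u3 : u ^+ 3 != 1) :
  ((flip 1 (flip w u) = flip v u) * (flip w (flip 1 u) = flip v u)
   * (flip 1 (flip v u) = flip w u) * (flip v (flip 1 u) = flip w u)
   * (flip w (flip v u) = flip 1 u) * (flip v (flip w u) = flip 1 u)
   * (flip 1 (flip 1 u) = u) * (flip w (flip w u) = u)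
   * (flip v (flip v u) = u))%type.
Proof.
have s0 : 1 + w + v = 0 by rewrite -addrA wv1 subrr.
have inv r : r ^+ 3 = 1 -> flip r (flip r u) = u.
  by move=> r3; exact: flipK (cube_root_neq0 r3) (cube_neq1 u3 r3).
do !split; try exact: inv; apply: flip_flip => //; rewrite 1?eq_sym //.
all: by rewrite -[RHS]s0; ring.
Qed.

Lemma klein_config_uniq b u : klein_generic u -> uniq (klein_config b u).
Proof.
case/and5P => u3 W0 _ _ _.
(* An involution maps a coincidence of two points of the orbit to a fixed
   point. *)
have D r t q : r ^+ 3 = 1 -> q ^+ 3 = 1 -> flip r (flip t u) = flip q u ->
    flip r u != flip t u.
  move=> r3 q3 rt; apply: contra_neq (flip_neq q3 u3 W0) => E.
  by rewrite -rt -E (flipK (cube_root_neq0 r3) (cube_neq1 u3 r3)).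
have D1 := flip_neq o3 u3 W0; have Dw := flip_neq w3 u3 W0.
have Dv := flip_neq v3 u3 W0.
have D1w : flip 1 u != flip w u by apply: (D _ _ v); rewrite ?(flip_group u3).
have D1v : flip 1 u != flip v u by apply: (D _ _ w); rewrite ?(flip_group u3).
have Dwv : flip w u != flip v u by apply: (D _ _ 1); rewrite ?(flip_group u3).
have -> : uniq (klein_config b u) = uniq (klein_config false u).
  by case: b; apply: perm_uniq; apply/permP => P /=; ring.
by rewrite /= !inE !negb_or ![u == _]eq_sym D1 Dw Dv D1w D1v Dwv.
Qed.

(** [newton_step_base] is the step of the coordinate at u.  The other three are
    its images by the involutions, which permute the orbit. *)
Lemma klein_config_step b u (i : nat) (z := (klein_config b u)`_i) :
    klein_generic u -> (escape_map u) ^+ 3 != 1 -> (i < 4)%N ->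
  exists t : seq F, [/\ perm_eq (klein_config b u) (z :: t),
    (quartic F).[z] != 0 &
    newton_sum (quartic F) t z * (z - (klein_config (~~ b) (escape_map u))`_i)
    = 1].
Proof.
move=> gu; set u' := escape_map u => u'3 i4.
have uu := klein_config_uniq false gu.
case/and5P: gu => u3 W0 p0 B0 C0.
have N1 := newton_step_base u3 W0 p0 B0 C0; rewrite -/u' in N1.
have step r : r ^+ 3 = 1 -> newton_sum (quartic F)
    [:: flip r (flip 1 u); flip r (flip w u); flip r (flip v u)] (flip r u) *
    (flip r u - flip r (flip 1 u')) = 1.
  move=> r3; apply: (newton_step_flip r3 u3 _ _ _ _ p0 N1) => //.
  - exact: flip_cube.
  - by case/andP: uu.
  - by rewrite /= !flip_cube.
have := step _ o3; rewrite !(flip_group u3, flip_group u'3) => S1.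
have := step _ w3; rewrite !(flip_group u3, flip_group u'3) => Sw.
have := step _ v3; rewrite !(flip_group u3, flip_group u'3) => Sv.
have P0 := quartic_flip_neq0 o3 (cube_neq1 u3 o3) p0.
have Pw := quartic_flip_neq0 w3 (cube_neq1 u3 w3) p0.
have Pv := quartic_flip_neq0 v3 (cube_neq1 u3 v3) p0.
have case_u : exists t : seq F, [/\ perm_eq (klein_config false u) (u :: t),
    (quartic F).[u] != 0 & newton_sum (quartic F) t u * (u - flip 1 u') = 1].
  by exists [:: flip 1 u; flip w u; flip v u].
have case_1 : exists t : seq F,
    [/\ perm_eq (klein_config false u) (flip 1 u :: t),
    (quartic F).[flip 1 u] != 0 &
    newton_sum (quartic F) t (flip 1 u) * (flip 1 u - u') = 1].
  exists [:: u; flip v u; flip w u]; split=> //.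
  by apply/permP => P /=; ring.
have case_w : exists t : seq F,
    [/\ perm_eq (klein_config false u) (flip w u :: t),
    (quartic F).[flip w u] != 0 &
    newton_sum (quartic F) t (flip w u) * (flip w u - flip v u') = 1].
  exists [:: flip v u; u; flip 1 u]; split=> //.
  by apply/permP => P /=; ring.
have case_v : exists t : seq F,
    [/\ perm_eq (klein_config false u) (flip v u :: t),
    (quartic F).[flip v u] != 0 &
    newton_sum (quartic F) t (flip v u) * (flip v u - flip w u') = 1].
  exists [:: flip w u; flip 1 u; u]; split=> //.
  by apply/permP => P /=; ring.
have any_order y y' :
    (exists t : seq F, [/\ perm_eq (klein_config false u) (y :: t),
      (quartic F).[y] != 0 & newton_sum (quartic F) t y * (y - y') = 1]) ->
    exists t : seq F, [/\ perm_eq (klein_config b u) (y :: t),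
      (quartic F).[y] != 0 & newton_sum (quartic F) t y * (y - y') = 1].
  have kb : perm_eq (klein_config b u) (klein_config false u).
    by case: (b) => //; apply/permP => P /=; ring.
  by case=> t [pt py nt]; exists t; split=> //; rewrite (permPl kb).
apply: any_order; rewrite /z.
by case: (b) i i4 {z} => [] [|[|[|[|//]]]] _ /=.
Qed.

End KleinStep.

(** * Escape on the real line *)

Section RealEscape.
Variable R : realFieldType.
Implicit Types u x h c : R.

(** In Horner form, a polynomial with leading coefficient at least 1 and no
    coefficient below -199 is positive from 200 on. *)
Lemma horner_step_ge1 x h c : 200 <= x -> 1 <= h -> -199 <= c -> 1 <= h * x + c.
Proof.
move=> x200 h1 c199; have : 200 <= h * x by nra.
by move=> ?; lra.
Qed.

(** With x = - u, the last inequality says that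
    - [escape_num u] >= 3 (- [escape_den u]) (1 + 2 x), whose two sides have
    degrees 9 and 8 in x.  The polynomials involved, and the difference of these
    two sides, satisfy the criterion above. *)
Lemma escape_map_le u : u <= -200 -> klein_generic u /\ escape_map u <= 2 * u.
Proof.
move=> u200; have [x xE x200] : exists2 x, u = - x & 200 <= x.
  by exists (- u); rewrite ?opprK // lerNr.
have st h c : 1 <= h -> -199 <= c -> 1 <= h * x + c by exact: horner_step_ge1.
have p1 : 1 <= (quartic R).[u].
  rewrite horner_quartic xE.
  rewrite (_ : _ + 1 = (((1 * x + 1) * x + 0) * x + -8) * x + 1); last by ring.
  by do !(apply: (st); last by lra); lra.
have W1 : 1 <= u ^+ 6 - 20 * u ^+ 3 - 8.
  rewrite xE (_ : _ - 8 = (((((1 * x + 0) * x + 0) * x + 20) * x + 0) * x + 0)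
    * x + -8); last by ring.
  by do !(apply: (st); last by lra); lra.
have B1 : 1 <= - escape_num u.
  rewrite xE (_ : - _ = ((((((((1 * x + 0) * x + 0) * x + 66) * x + 27) * x + 0)
    * x + 48) * x + -54) * x + 0) * x + 64); last by rewrite /escape_num; ring.
  by do !(apply: (st); last by lra); lra.
have C1 : 1 <= - escape_den u.
  rewrite xE (_ : - _ = ((((((6 * x + 8) * x + 3) * x + 24) * x + -2) * x + -6)
    * x + 0) * x + 8); last by rewrite /escape_den; ring.
  by do !(apply: (st); last by lra); lra.
have D1 : 1 <= - escape_num u - 3 * - escape_den u * (1 - 2 * u).
  rewrite xE (_ : _ - _ = ((((((((1 * x + -36) * x + -66) * x + 24) * x + -126)
    * x + -60) * x + 90) * x + -36) * x + -48) * x + 40);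
    last by rewrite /escape_num /escape_den; ring.
  by do !(apply: (st); last by lra); lra.
split.
  have u3 : u ^+ 3 < 1.
    rewrite (lt_trans _ ltr01) // exprn_odd_lt0 //; lra.
  rewrite /klein_generic (lt_eqF u3) /=.
  apply/and4P; split; apply/eqP => E0; rewrite E0 in p1 W1 B1 C1; lra.
have C0 : 0 < 3 * - escape_den u by lra.
rewrite /escape_map.
have -> : escape_num u / (3 * escape_den u)
    = - escape_num u / (3 * - escape_den u) by field; lra.
by rewrite lerBlDr -lerBlDl ler_pdivlMr //; lra.
Qed.

Definition escape_orbit (n : nat) : R := iter n (@escape_map R) (-200).

Lemma escape_orbit_le n : escape_orbit n <= -200 - n%:R.
Proof.
elim: n => [|n IH]; first by rewrite subr0.
have n0 : 0 <= n%:R :> R by exact: ler0n.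
have u200 : escape_orbit n <= -200 by lra.
have [_ e] := escape_map_le u200.
rewrite -[escape_orbit n.+1]/(escape_map (escape_orbit n)) -natr1.
lra.
Qed.

Lemma escape_orbit_le200 n : escape_orbit n <= -200.
Proof. by have := escape_orbit_le n; have : 0 <= n%:R :> R by []; lra. Qed.

End RealEscape.

(** * The complex orbit *)

Section Transfer.
Variables (F K : numFieldType) (f : {rmorphism F -> K}).

Lemma rmorph_escape_num u : f (escape_num u) = escape_num (f u).
Proof. by rewrite /escape_num; ring. Qed.

Lemma rmorph_escape_den u : f (escape_den u) = escape_den (f u).
Proof. by rewrite /escape_den; ring. Qed.

Lemma rmorph_escape_map u : f (escape_map u) = escape_map (f u).
Proof.
rewrite /escape_map -rmorph_escape_num -rmorph_escape_den rmorphB rmorph1.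
by rewrite fmorph_div rmorphM rmorph_nat.
Qed.

Lemma rmorph_quartic u : f (quartic F).[u] = (quartic K).[f u].
Proof. by rewrite !horner_quartic; ring. Qed.

Lemma rmorph_flip1 u : f (flip 1 u) = flip 1 (f u).
Proof. by rewrite !flipE fmorph_div; congr (_ * _^-1); ring. Qed.

Lemma klein_generic_rmorph u : klein_generic (f u) = klein_generic u.
Proof.
rewrite /klein_generic -rmorph_escape_num -rmorph_escape_den -rmorph_quartic.
have <- : f (u ^+ 6 - 20 * u ^+ 3 - 8) = f u ^+ 6 - 20 * f u ^+ 3 - 8 by ring.
by rewrite !fmorph_eq0 -rmorphXn fmorph_eq1.
Qed.

End Transfer.

Section Assembly.
Variable R : realType.
Local Notation C := (complex R).
Local Notation toC := (real_complex R).

Lemma not_real_cube_root (w : C) (c : R) : w ^+ 2 + w + 1 = 0 -> w != toC c.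
Proof.
move=> hw; apply/eqP => wc; have : toC (c ^+ 2 + c + 1) = toC 0.
  by rewrite !rmorphD /= rmorphXn /= -wc rmorph1 rmorph0.
by move/complexI; nra.
Qed.

Lemma ex_cube_roots : exists w v : C, [/\ w + v = -1, w * v = 1 & w != v].
Proof.
have [w hw] : exists w : C, w ^+ 2 + w + 1 = 0.
  have [//|w] := @solve_monicpoly C 2 (fun=> -1).
  rewrite !big_ord_recl big_ord0 /= => hw; exists w.
  by rewrite hw; ring.
exists w, (-1 - w); split; [by ring| |].
  by apply/eqP; rewrite -subr_eq0; apply/eqP; rewrite -[RHS]oppr0 -hw; ring.
apply/eqP => e; suff /eqP : w = toC (- 2^-1).
  by apply/negP; exact: not_real_cube_root.
have -> : w = (w - (-1 - w)) / 2 - 2^-1 by field.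
by rewrite {1}e subrr mul0r add0r rmorphN fmorphV rmorph_nat.
Qed.

(** For u and a real, [flip w u] = a reads w (u + a - 2) = a u + 2, and w is not
    real. *)
Lemma flip_not_real (w : C) (u a : R) :
  w ^+ 2 + w + 1 = 0 -> u <= -200 -> 0 <= a -> flip w (toC u) != toC a.
Proof.
move=> hw u200 a0; have uw : toC u != w by rewrite eq_sym not_real_cube_root.
apply/eqP => e; have {}e : w * toC (u + a - 2) = toC (a * u + 2).
  have /eqP : flip w (toC u) * (toC u - w) = toC a * (toC u - w) by rewrite e.
  rewrite flipE mulfVK ?subr_eq0 // -subr_eq0 => /eqP E.
  apply/eqP; rewrite -subr_eq0; apply/eqP.
  rewrite !(rmorphB, rmorphD, rmorphM, rmorph_nat).
  transitivity (w * (toC u + 2 * w) - toC a * (toC u - w)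
    - 2 * (w ^+ 2 + w + 1)).
    by ring.
  by rewrite E hw mulr0 subr0.
have ua : u + a - 2 != 0.
  apply/eqP => ua; move: e; rewrite ua rmorph0 mulr0 -[0](rmorph0 toC).
  by move/complexI; nra.
have /negP := not_real_cube_root ((a * u + 2) / (u + a - 2)) hw.
apply; apply/eqP.
have uaC : toC (u + a - 2) != 0 by rewrite fmorph_eq0.
by apply: (mulIf uaC); rewrite e -[RHS]rmorphM divfK.
Qed.

(** The additional roots, which are also the additional coordinates.  They are
    real and at least 2, away from infinity and from the cube roots of unity,
    which the first four coordinates accumulate at. *)
Definition spectators m : seq C := [seq k.+2%:R | k <- iota 0 m].

Lemma spectators_uniq m : uniq (spectators m).
Proof.
rewrite map_inj_in_uniq ?iota_uniq // => i j _ _ /eqP.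
by rewrite eqr_nat => /eqP[].
Qed.

Lemma spectatorsP m z : z \in spectators m -> exists2 a : R, z = toC a & 2 <= a.
Proof.
case/mapP => k _ ->; exists k.+2%:R; first by rewrite rmorph_nat.
by rewrite ler_nat.
Qed.

Lemma quartic_spectator m z : z \in spectators m -> (quartic C).[z] != 0.
Proof.
case/spectatorsP => a -> a2.
rewrite -(rmorph_quartic toC) fmorph_eq0 horner_quartic.
by apply/eqP; nra.
Qed.

Lemma klein_config_spectators (w v : C) b u m z :
    w ^+ 2 + w + 1 = 0 -> v ^+ 2 + v + 1 = 0 -> u <= -200 ->
  z \in spectators m -> z \notin klein_config w v b (toC u).
Proof.
move=> hw hv u200 /spectatorsP[a -> a2].
have nw := flip_not_real hw u200 (le_trans (ler0n _ 2) a2).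
have nv := flip_not_real hv u200 (le_trans (ler0n _ 2) a2).
have n0 : toC u != toC a.
  by rewrite (inj_eq (@complexI R)); apply/eqP; lra.
have n1 : flip 1 (toC u) != toC a.
  rewrite -(rmorph_flip1 toC) (inj_eq (@complexI R)) flipE mul1r mulr1.
  have u1 : u - 1 != 0 by apply/eqP; lra.
  apply/eqP => e; have : u + 2 = a * (u - 1) by rewrite -e mulfVK.
  nra.
by case: b; rewrite !inE !negb_or ![toC a == _]eq_sym n0 n1 nw nv.
Qed.

Lemma quartic_roots : exists r : seq C,
  [/\ size r = 4, uniq r & all (root (quartic C)) r].
Proof.
have [r qE] := closed_field_poly_normal (quartic C).
have c0 : lead_coef (quartic C) != 0.
  by rewrite lead_coef_eq0 -size_poly_eq0 size_quartic.
exists r; split.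
- have := size_quartic C; rewrite qE size_scale // size_prod_XsubC.
  by case.
- rewrite -separable.separable_prod_XsubC separable.separable_poly.unlock.
  apply/Pdiv.ClosedField.coprimepP => z rz; apply/eqP => z'.
  have qz : root (quartic C) z by rewrite qE rootZ.
  by move: (quartic_no_double_root qz); rewrite qE derivZ hornerZ z' mulr0 eqxx.
- by apply/allP => z zr; rewrite qE rootZ // root_prod_XsubC.
Qed.

Lemma cnorm_ge (n : nat) (x : 'rV[C]_n) i u : x 0 i = toC u -> - u <= cnorm x.
Proof.
move=> xi; apply: (@le_trans _ _ `|u|); first by rewrite -normrN ler_norm.
rewrite -sqrtr_sqr /cnorm ler_wsqrtr // (bigD1 i) //= xi /= expr0n addr0.
rewrite sqrtr_sqr real_normK ?num_real // lerDl sumr_ge0 // => j _.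
exact: sqr_ge0.
Qed.

Definition orbit_seq (w v : C) m j : seq C :=
  klein_config w v (odd j) (toC (escape_orbit R j)) ++ spectators m.

Definition witness m : {poly C} := quartic C * root_poly (spectators m).

Lemma size_spectators m : size (spectators m) = m.
Proof. by rewrite size_map size_iota. Qed.

Lemma size_witness m : size (witness m) = m.+4.+1.
Proof.
rewrite size_Mmonic ?monic_prod_XsubC // -?size_poly_gt0 size_quartic //.
by rewrite size_prod_XsubC size_spectators.
Qed.

Lemma witness_roots m : exists rs : seq C,
  [/\ size rs = m.+4, uniq rs & all (root (witness m)) rs].
Proof.
have [r [sr ur /allP rr]] := quartic_roots; exists (r ++ spectators m); split.
- by rewrite size_cat sr size_spectators.
- rewrite cat_uniq ur spectators_uniq andbT; apply/hasPn => z zs.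
  by apply: contra (quartic_spectator zs) => /rr.
- apply/allP => z; rewrite mem_cat rootM root_prod_XsubC.
  by case/orP => [/rr -> | ->]; rewrite ?orbT.
Qed.

Section Orbit.
Variables (w v : C) (m : nat).
Hypotheses (wv1 : w + v = -1) (wvM : w * v = 1) (wv : w != v).
Local Notation s j := (orbit_seq w v m j).

Lemma orbit_generic j : klein_generic (toC (escape_orbit R j)).
Proof.
by rewrite klein_generic_rmorph; case: (escape_map_le (escape_orbit_le200 R j)).
Qed.

Lemma size_orbit_seq j : size (s j) = m.+4.
Proof. by rewrite size_cat size_spectators; case: odd. Qed.

Lemma orbit_seq_uniq j : uniq (s j).
Proof.
rewrite cat_uniq klein_config_uniq ?orbit_generic // spectators_uniq andbT.
apply/hasPn => z; apply: klein_config_spectators;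
  rewrite ?escape_orbit_le200 //.
  exact: cube_root_eq wv1 wvM.
by apply: (@cube_root_eq _ _ w); rewrite 1?addrC 1?mulrC.
Qed.

Lemma orbit_step j :
  ratmap_value (JEA m.+4 (witness m)) (\row_k (s j)`_k) (\row_k (s j.+1)`_k).
Proof.
move=> i; rewrite [X in ratfun_value _ _ X]mxE.
have size4 b u : size (klein_config w v b u) = 4 by case: b.
have [i4|i4] := ltnP i 4.
  have u'3 : (escape_map (toC (escape_orbit R j))) ^+ 3 != 1.
    rewrite -(rmorph_escape_map toC) -[escape_map _]/(escape_orbit R j.+1).
    by case/and5P: (orbit_generic j.+1).
  have [t [pt q0 N1]] :=
    klein_config_step wv1 wvM wv (odd j) (orbit_generic j) u'3 i4.
  have si : (s j)`_i = (klein_config w v (odd j) (toC (escape_orbit R j)))`_i.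
    by rewrite nth_cat size4 i4.
  have si' : (s j.+1)`_i
      = (klein_config w v (~~ odd j) (escape_map (toC (escape_orbit R j))))`_i.
    by rewrite nth_cat size4 i4 /= -(rmorph_escape_map toC).
  apply: (JEA_value_newton_sum (size_orbit_seq j) (orbit_seq_uniq j) (t := t));
    rewrite si ?si' //.
  by rewrite /orbit_seq -cat_cons perm_cat2r.
have si : (s j.+1)`_i = (s j)`_i by rewrite !nth_cat !size4 ltnNge i4.
have mem : (s j)`_i \in spectators m.
  rewrite nth_cat size4 ltnNge i4 mem_nth // size_spectators.
  by rewrite ltn_subLR // -[(4 + m)%N]/m.+4.
rewrite si.
apply: (JEA_value_simple_root (size_orbit_seq j) (orbit_seq_uniq j)).
  by rewrite rootM root_prod_XsubC mem orbT.
rewrite derivM hornerD !hornerM.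
have /rootP -> : root (root_poly (spectators m)) (s j)`_i.
  by rewrite root_prod_XsubC.
rewrite mulr0 add0r mulf_neq0 ?(quartic_spectator mem) //.
exact: root_poly_deriv_neq0 (spectators_uniq _) mem.
Qed.

Lemma orbit_diverges :
  cnorm (\row_(k < m.+4) (s j)`_k) @[j --> \oo] --> +oo.
Proof.
apply/cvgryPge => A; near=> j.
have Aj : A <= j%:R by near: j; exact: nbhs_infty_ger.
have uj := escape_orbit_le R j.
(* The coordinate that is equal to the real iterate at time [j]. *)
pose i : 'I_m.+4 := if odd j then Ordinal (isT : (1 < m.+4)%N) else ord0.
have si : (\row_(k < m.+4) (s j)`_k) 0 i = toC (escape_orbit R j).
  by rewrite mxE /i /orbit_seq; case: odd.
by apply: le_trans (cnorm_ge si); lra.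
Unshelve. all: by end_near. Qed.

End Orbit.
End Assembly.

Theorem theorem1 (R : realType) (d : nat) (hd : (4 <= d)%N) :
  exists p : {poly (complex R)},
    [/\ size p = d.+1,
        exists rs : seq (complex R), [/\ size rs = d, uniq rs & all (root p) rs] &
        exists x : nat -> 'rV[complex R]_d, diverging_orbit (JEA d p) x].
Proof.
have {hd} [m ->] : exists m, d = m.+4.
  by exists (d - 4)%N; rewrite -[RHS]addn4 subnK.
have [w [v [wv1 wvM wv]]] := ex_cube_roots R.
exists (witness R m); split.
- exact: size_witness.
- exact: witness_roots.
- exists (fun j => \row_(k < m.+4) (orbit_seq w v m j)`_k); split.
  + by move=> j; exact: orbit_step.
  + exact: orbit_diverges.
Qed.
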